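(* Let $(S(n),F(n))$, $n=1,2,\ldots$, be a centered martingale on a probability space $(\Omega,F,\mathbf P)$, with $\mathbf E S(n)=0$, $\mathbf E[S(n+1)\mid F(n)]=S(n)$ and $\sigma(n)=[\mathbf{Var}(S(n))]^{1/2}\in(0,\infty)$ for all $n$. Let $v=(v(n))$ be a deterministic positive monotonically increasing sequence. Suppose that there exists a function $\phi\in\Phi$ such that $$\sup_n\left[\|S(n)\|_{B(\phi)}/\sigma(n)\right]<\infty .$$ Put $$W(v;u)=\mathbf P\left(\sup_n\frac{S(n)}{\sigma(n)\,v(n)}>u\right),\qquad W_+(v;u)=\mathbf P\left(\sup_n\frac{|S(n)|}{\sigma(n)\,v(n)}>u\right).$$ Then, for some finite $C=C(\phi)$, $$W(v;u)\le\inf_{R\in T}Q(R,v,Cu),$$ and an analogous estimation is true for the probability $W_+(v;u)$. Here $\Phi$, $\|\cdot\|_{B(\phi)}$, $T$ and $Q(R,v,u)$ are as defined in the context.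
   Context: **The class $\Phi$.** $\Phi$ is the set of all even, strictly convex, twice continuously differentiable functions $\phi=\phi(\lambda)$, $\lambda\in(-\lambda_0,\lambda_0)$, where $\lambda_0=\mathrm{const}\in(0,\infty]$, which take positive values for positive arguments and satisfy $\phi(0)=0$ and $\lim_{\lambda\to\lambda_0}\phi(\lambda)/\lambda=\infty$. **The space $B(\phi)$.** A centered random variable $\xi$ belongs to $B(\phi)$ if there is a constant $\tau\ge0$ such that $\mathbf E\exp(\lambda\xi)\le\exp(\phi(\lambda\tau))$ for all $\lambda\in(-\lambda_0,\lambda_0)$. The minimal such $\tau$ is its norm: $$\|\xi\|_{B(\phi)}=\inf\{\tau>0:\ \forall\lambda\ \ \mathbf E\exp(\lambda\xi)\le\exp(\phi(\lambda\tau))\}.$$ **Young–Fenchel transform.** $\phi^*(x)=\sup_{\lambda}(\lambda x-\phi(\lambda))$. **Partitions.** $T$ is the set of all partitions $R=\{A(k),B(k)\}$ of the positive integers of the form $\{1,2,\ldots\}=\cup_{k=1}^\infty[A(k),B(k)]$, where $A(k)$, $k=1,2,\ldots$, is a deterministic positive strictly increasing integer sequence with $A(1)=1$, and $B(k)=A(k+1)-1\ge A(k)+1$. **The quantity $Q$.** For $R=\{A(k),B(k)\}\in T$, $$Q(R,v,u)=\sum_{k=1}^\infty\exp\left(-\phi^*\left(\frac{u\,\sigma(A(k))\,v(A(k))}{\sigma(B(k))}\right)\right).$$ **Range of $u$.** The theorem does not specify the range of $u$; the stated aim is to estimate $W$ and $W_+$ for sufficiently large $u$, for example $u\ge2$.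
   Formalization: The constant C depends on φ and also on the value sup_n ‖S(n)‖_{B(φ)}/σ(n), since no positive C depending on φ alone can serve all martingales; the bound is stated for all u>0, and the bound for W_+ carries a factor 2. *)

(* Defs.v *)
From HB Require Import structures.
From mathcomp Require Import all_boot all_order all_algebra.
From mathcomp Require Import all_classical all_reals all_analysis.

Set Implicit Arguments.
Unset Strict Implicit.
Unset Printing Implicit Defensive.

Import Order.TTheory GRing.Theory Num.Theory.
Import numFieldNormedType.Exports.

Local Open Scope classical_set_scope.
Local Open Scope ring_scope.

(** All sequences are indexed from 0: index [n] here stands for the index
    [n + 1] of a sequence [n = 1, 2, ...]. *)

Section Phi.
Context {R : realType}.

Definition symitv (l0 : \bar R) : set R := [set l | (`|l|%:E < l0)%E].

Definition nbhs_endpoint (l0 : \bar R) : set_system R :=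
  match l0 with
  | r%:E => r^'-
  | +oo%E => pinfty_nbhs R
  | -oo%E => ninfty_nbhs R (* irrelevant: only used for [0 < l0] *)
  end.

(** The values of [phi] outside of [symitv l0] are irrelevant. *)
Record classPhi (l0 : \bar R) (phi : R -> R) : Prop := ClassPhi {
  Phi_l0 : (0 < l0)%E ;
  Phi_even : forall l, symitv l0 l -> phi (- l) = phi l ;
  Phi_strictly_convex : forall x y t : R, symitv l0 x -> symitv l0 y ->
    x != y -> 0 < t -> t < 1 ->
    phi (t * x + (1 - t) * y) < t * phi x + (1 - t) * phi y ;
  Phi_derivable : forall l, symitv l0 l -> derivable phi l 1 ;
  Phi_derivable2 : forall l, symitv l0 l -> derivable (phi^`())%classic l 1 ;
  Phi_continuous2 : forall l, symitv l0 l -> {for l, continuous (phi^`(2))%classic} ;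
  Phi_pos : forall l, symitv l0 l -> 0 < l -> 0 < phi l ;
  Phi_0 : phi 0 = 0 ;
  Phi_lim : phi l / l @[l --> nbhs_endpoint l0] --> +oo }.

(** [l * tau] may leave the domain of [phi], so [phi] is extended by [+oo]. *)
Definition phi_ext (l0 : \bar R) (phi : R -> R) (l : R) : \bar R :=
  if (`|l|%:E < l0)%E then (phi l)%:E else +oo%E.

Definition young_fenchel (l0 : \bar R) (phi : R -> R) (x : R) : \bar R :=
  ereal_sup [set (l * x - phi l)%:E | l in symitv l0].

End Phi.

Section Bphi.
Context {R : realType} (l0 : \bar R) (phi : R -> R).
Context {d : measure_display} {Omega : measurableType d}.
Variable P : probability Omega R.

Definition inBphi (X : {RV P >-> R}) : Prop :=
  'E_P[X]%E = 0%E /\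
  exists2 tau : R, 0 <= tau & forall l, symitv l0 l ->
    ('M_P X l <= expeR (phi_ext l0 phi (l * tau)))%E.

(** Here [l] ranges over all reals. Since [phi_ext] is [+oo] off
    [symitv l0], the condition only bears on [`|l * tau| < l0], which makes the
    norm homogeneous; restricting [l] itself to [symitv l0] would not when
    [tau < 1]. The value is [+oo] when no [tau] is suitable. *)
Definition Bphi_norm (X : {RV P >-> R}) : \bar R :=
  ereal_inf [set tau%:E | tau in [set tau : R | 0 < tau /\
    forall l : R, ('M_P X l <= expeR (phi_ext l0 phi (l * tau)))%E]].

End Bphi.

Section Martingale.
Context {R : realType} {d : measure_display} {Omega : measurableType d}.
Variable P : probability Omega R.

Definition stdev (X : {RV P >-> R}) : R := Num.sqrt (fine 'V_P[X]).

(** [Y] is a version of the conditional expectation E[X | G]. *)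
Definition is_cond_exp (G : set (set Omega)) (X Y : {RV P >-> R}) : Prop :=
  [/\ forall B : set R, measurable B -> G (Y @^-1` B),
      P.-integrable setT (EFin \o Y) &
      forall A, G A -> (\int[P]_(w in A) (Y w)%:E = \int[P]_(w in A) (X w)%:E)%E].

Definition filtration (F : nat -> set (set Omega)) : Prop :=
  (forall n, sigma_algebra setT (F n)) /\
  (forall n, F n `<=` measurable) /\
  (forall n, F n `<=` F n.+1).

Definition centered_martingale (S : nat -> {RV P >-> R})
    (F : nat -> set (set Omega)) : Prop :=
  [/\ filtration F,
      forall n, P.-integrable setT (EFin \o S n),
      forall n, is_cond_exp (F n) (S n.+1) (S n) &
      forall n, 'E_P[S n]%E = 0%E].

Definition W (S : nat -> {RV P >-> R}) (v : nat -> R) (u : R) : \bar R :=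
  P [set w | (u%:E <
    ereal_sup [set (S n w / (stdev (S n) * v n))%:E | n in [set: nat]])%E].

Definition Wplus (S : nat -> {RV P >-> R}) (v : nat -> R) (u : R) : \bar R :=
  P [set w | (u%:E <
    ereal_sup [set (`|S n w| / (stdev (S n) * v n))%:E | n in [set: nat]])%E].

End Martingale.

(** A partition into blocks [{A k, ..., B k}] is determined by the sequence [A]
    of left endpoints; [A 0 = 0] and [B k = A k.+1 - 1] make the blocks cover
    [nat]. *)
Definition right_end (A : nat -> nat) (k : nat) : nat := (A k.+1).-1.

Definition partitions : set (nat -> nat) :=
  [set A | [/\ A 0%N = 0%N,
               forall k, (A k < A k.+1)%N &
               forall k, (A k + 1 <= right_end A k)%N]].

Definition Q {R : realType} (l0 : \bar R) (phi : R -> R) (sigma : nat -> R)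
    (A : nat -> nat) (v : nat -> R) (u : R) : \bar R :=
  (\sum_(0 <= k <oo) expeR (- young_fenchel l0 phi
      (u * sigma (A k) * v (A k) / sigma (right_end A k))%R))%E.

(* Main.v *)
Require Import Defs.
From HB Require Import structures.
From mathcomp Require Import all_boot all_order all_algebra.
From mathcomp Require Import all_classical all_reals all_analysis.
From mathcomp Require Import measurable_realfun.
From mathcomp Require Import ring lra.

Set Implicit Arguments.
Unset Strict Implicit.
Unset Printing Implicit Defensive.

Import Order.TTheory GRing.Theory Num.Theory.
Import numFieldNormedType.Exports.

Local Open Scope classical_set_scope.
Local Open Scope ring_scope.

(** The probability of exceeding the level [u] at some time is bounded block by
    block. In a block [m, n] of a partition, [sigma] and [v] are nondecreasing, so
    [S i > u * sigma i * v i] for some [i] of the block forces the martingale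
    above the single level [x = u * sigma m * v m]. A maximal inequality bounds
    the probability of this by [exp (- lambda x) * E exp (lambda (S n))] for every
    [lambda > 0]. If [tau] is admissible for the norm of [S n] and
    [lambda = l / tau], the bound is [exp (- (l * (x / tau) - phi l))]; as
    [tau < (K + 1) * sigma n], the infimum over [l] of these bounds is at most
    [exp (- phi^* (x / ((K + 1) * sigma n)))], which is the term of [Q] with
    [C = 1 / (K + 1)] ([maximal_young_fenchel]). Summing over the blocks gives
    [W]. Since [phi] is even, the same holds for [- S], and the union of the two
    events gives [Wplus] with the factor 2.

    Both martingale facts that are used, the maximal inequality
    ([doob_chernoff]) and the monotonicity of [sigma] ([martingale_sqr_le]), are
    instances of Jensen's inequality on one event of the filtration
    ([martingale_jensen]). There a convex function only has to be compared with
    one affine function, whose integral over the event is the same for [S m] and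
    [S n]; no conditional expectation of a function of [S n] occurs. *)

(** * Martingale inequalities from affine comparison *)

Section martingale_inequalities.
Context {R : realType} {d : measure_display} {Omega : measurableType d}.
Variable P : probability Omega R.

(** An affine function separates [f] from [g], and its integral over [D] does not
    distinguish [X] from [Y]. The bound on [f] is needed only at the values of
    [X] on [D], so [f] may be a constant or, if [X] varies little on [D], the
    convex function [g] up to a small error. *)
Lemma integral_affine_le (D : set Omega) (X Y : {RV P >-> R}) (f g : R -> R)
    (a b : R) :
  measurable D ->
  P.-integrable setT (EFin \o X) -> P.-integrable setT (EFin \o Y) ->
  (\int[P]_(w in D) (X w)%:E = \int[P]_(w in D) (Y w)%:E)%E ->
  measurable_fun setT f -> measurable_fun setT g ->
  (forall y, 0 <= f y) -> (forall y, 0 <= g y) ->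
  (forall w, D w -> f (X w) <= a * X w + b) ->
  (forall y, a * y + b <= g y) ->
  (\int[P]_(w in D) (f (X w))%:E <= \int[P]_(w in D) (g (Y w))%:E)%E.
Proof.
move=> mD iX iY XY mf mg f0 g0 fX gY.
have iXD : P.-integrable D (EFin \o X) by exact: integrableS iX.
have iYD : P.-integrable D (EFin \o Y) by exact: integrableS iY.
have ib : P.-integrable D (EFin \o cst b) by exact: finite_measure_integrable_cst.
have affE (Z : Omega -> R) : P.-integrable D (EFin \o Z) ->
    (\int[P]_(w in D) (a * Z w + b)%:E =
     a%:E * \int[P]_(w in D) (Z w)%:E + \int[P]_(w in D) b%:E)%E.
  move=> iZ; under eq_integral do rewrite EFinD EFinM.
  by rewrite integralD//= ?integralZl//; exact: integrableZl.
have mX : measurable_fun D X by exact: measurable_funTS.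
have mY : measurable_fun D Y by exact: measurable_funTS.
have mfX : measurable_fun D (EFin \o (f \o X)).
  by apply/measurable_EFinP; exact: measurableT_comp.
have mgY : measurable_fun D (EFin \o (g \o Y)).
  by apply/measurable_EFinP; exact: measurableT_comp.
have maff (Z : Omega -> R) : measurable_fun D Z ->
    measurable_fun D (EFin \o (fun w => a * Z w + b)).
  move=> mZ; apply/measurable_EFinP.
  by apply: measurable_funD => //; exact: measurable_funM.
apply: (@le_trans _ _ (\int[P]_(w in D) (a * X w + b)%:E)%E).
  apply: ge0_le_integral => //.
  - by move=> w _; rewrite lee_fin.
  - exact: maff.
rewrite affE// XY -affE//.
(* [g \o Y] may have infinite integral: it is compared with the positive part
   of the affine function instead. *)
rewrite integralE; apply: (@le_trans _ _
    (\int[P]_(w in D) ((fun w => (a * Y w + b)%:E)^\+ w))%E).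
  rewrite -[leRHS]sube0 leeB//; exact: integral_ge0.
apply: ge0_le_integral => //.
- by apply: measurable_funepos; exact: maff.
- by move=> w Dw; rewrite funeposE -EFin_max lee_fin ge_max gY g0.
Qed.

Variables (S : nat -> {RV P >-> R}) (F : nat -> set (set Omega)).
Hypothesis SF : centered_martingale S F.

Lemma filtration_measurable n A : F n A -> measurable A.
Proof. by case: SF => -[_ []] + _ _ _ _ => /(_ n)/[apply]. Qed.

Lemma filtration_le m n A : (m <= n)%N -> F m A -> F n A.
Proof.
move=> mn FA; elim: n mn => [|n IH]; first by rewrite leqn0 => /eqP <-.
rewrite leq_eqVlt => /predU1P[<-//|/IH FnA].
by case: SF => -[_ [_ +]] _ _ _; apply.
Qed.

(** It lets [F n] be used as the measurable sets of [g_sigma_algebraType (F n)]. *)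
Lemma filtration_gen n : <<s F n>> = F n.
Proof. by case: SF => -[sF _] _ _ _; exact: sigma_algebra_id. Qed.

Lemma martingale_adapted n (B : set R) : measurable B -> F n (S n @^-1` B).
Proof. by case: SF => _ _ /(_ n)[+ _ _] _; exact. Qed.

Lemma martingale_set_integral m n D : (m <= n)%N -> F m D ->
  (\int[P]_(w in D) (S m w)%:E = \int[P]_(w in D) (S n w)%:E)%E.
Proof.
move=> mn FD; elim: n mn => [|n IH]; first by rewrite leqn0 => /eqP <-.
rewrite leq_eqVlt => /predU1P[<-//|mn].
rewrite IH//; case: SF => _ _ /(_ n)[_ _ +] _; apply.
exact: filtration_le FD.
Qed.

Lemma martingale_jensen m n D (f g : R -> R) (a b : R) : (m <= n)%N -> F m D ->
  measurable_fun setT f -> measurable_fun setT g ->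
  (forall y, 0 <= f y) -> (forall y, 0 <= g y) ->
  (forall w, D w -> f (S m w) <= a * S m w + b) ->
  (forall y, a * y + b <= g y) ->
  (\int[P]_(w in D) (f (S m w))%:E <= \int[P]_(w in D) (g (S n w))%:E)%E.
Proof.
move=> mn FD mf mg f0 g0 fX gY; case: (SF) => _ iS _ _.
apply: (@integral_affine_le _ _ _ _ _ a b) => //.
  exact: filtration_measurable FD.
exact: martingale_set_integral.
Qed.

(** The union is cut into the events [seqDU E i] that [E i] is the first to occur,
    which lie in [F i] and are disjoint. On each of them [expR (l * S n)] has
    integral at least [expR x] times the probability, by the tangent of
    [expR (l * y)] at the point where [l * y = x]. The sign of [l] is
    arbitrary, so that [- S] needs no separate treatment. *)
Lemma doob_chernoff n (l x : R) (E : nat -> set Omega) :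
  (forall i, F i (E i)) ->
  (forall i w, (i <= n)%N -> E i w -> x <= l * S i w) ->
  (P (\big[setU/set0]_(i < n.+1) E i) <= (expR (- x))%:E * 'M_P (S n) l)%E.
Proof.
move=> FE Ex.
have mE i : measurable (E i) by exact: filtration_measurable (FE i).
have FD i : F i (seqDU E i).
  rewrite -filtration_gen.
  apply: (@measurableD _ (g_sigma_algebraType (F i))).
    by rewrite /measurable/= filtration_gen.
  apply: (@bigsetU_measurable _ (g_sigma_algebraType (F i))) => j _.
  by rewrite /measurable/= filtration_gen; apply: filtration_le (FE j); exact: ltnW.
have mD i : measurable (seqDU E i) by exact: filtration_measurable (FD i).
pose G w := (expR (l * S n w))%:E : \bar R.
have mG : measurable_fun setT G.
  apply/measurable_EFinP; apply: measurableT_comp => //.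
  exact: measurable_funM.
have step i : (i < n.+1)%N ->
    ((expR x)%:E * P (seqDU E i) <= \int[P]_(w in seqDU E i) G w)%E.
  rewrite ltnS => lein; rewrite -integral_cst//.
  apply: (@martingale_jensen i n _ (cst (expR x)) (fun y => expR (l * y))
    (expR x * l) (expR x * (1 - x))) => //.
  - apply: measurableT_comp => //; exact: measurable_funM.
  - by move=> y; rewrite /= expR_ge0.
  - move=> w [Ew _] /=; have := Ex _ _ lein Ew; have := expR_gt0 x.
    move=> ex0 xl; rewrite -mulrA -mulrDr (ler_peMr (ltW ex0))//; lra.
  - move=> y; have := expR_ge1Dx (l * y - x).
    rewrite expRD expRN ler_pdivlMr ?expR_gt0// => /(le_trans _); apply.
    by rewrite le_eqVlt; apply/orP; left; apply/eqP; ring.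
have EG : ('M_P (S n) l = \int[P]_w G w)%E.
  rewrite /mmt_gen_fun unlock; apply: eq_integral => w _.
  by rewrite /G /= mulrC.
suff H : ((expR x)%:E * P (\big[setU/set0]_(i < n.+1) E i) <= 'M_P (S n) l)%E.
  rewrite expRN; rewrite muleC lee_pdivlMr ?expR_gt0//.
  by rewrite muleC.
rewrite bigsetU_seqDU -(big_mkord xpredT (seqDU E)) -integral_cst//=; last first.
  exact: bigsetU_measurable.
have uI : uniq (index_iota 0 n.+1) by exact: iota_uniq.
have tD : trivIset [set` index_iota 0 n.+1] (seqDU E).
  exact: sub_trivIset (@trivIset_seqDU _ E).
rewrite ge0_integral_bigsetU//.
apply: (@le_trans _ _ (\sum_(0 <= i < n.+1) \int[P]_(w in seqDU E i) G w)%E).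
  rewrite !big_mkord; apply: lee_sum => i _.
  by rewrite integral_cst//; exact: step.
rewrite -ge0_integral_bigsetU//; last 2 first.
- exact: measurable_funTS.
- by move=> w _; rewrite lee_fin expR_ge0.
rewrite EG; apply: ge0_subset_integral => //.
- exact: bigsetU_measurable.
- by move=> w _; rewrite lee_fin expR_ge0.
Qed.

(** The range of [S m] is cut into intervals of length [sqrt e]. On the event that
    [S m] is in the interval starting at [c], the tangent of the square at [c]
    differs from [S m ^+ 2] by [(S m - c) ^+ 2 <= e]; the total error is at
    most [e]. *)
Lemma martingale_sqr_le m n : (m <= n)%N ->
  (\int[P]_w ((S m w) ^+ 2)%:E <= \int[P]_w ((S n w) ^+ 2)%:E)%E.
Proof.
move=> mn; apply/lee_addgt0Pr => e e0.
pose eps := Num.sqrt e; have eps0 : 0 < eps by rewrite sqrtr_gt0.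
(* [pickle] numbers the intervals, which are indexed by integers, by naturals. *)
pose cell (k : nat) : set R := [set x | pickle (Num.floor (x / eps)) = k].
pose D k := S m @^-1` cell k.
have cellE k : cell k !=set0 -> exists z : int, cell k = `[z%:~R * eps, (z + 1)%:~R * eps[%classic.
  move=> [x xk]; exists (Num.floor (x / eps)); apply/seteqP; split => y /=.
    rewrite -xk => /(pcan_inj (@pickleK _)) <-.
    by rewrite in_itv/= -ler_pdivlMr// -ltr_pdivrMr// floor_itv.
  rewrite in_itv/= -ler_pdivlMr// -ltr_pdivrMr// => yz.
  by rewrite /cell /= -xk; congr pickle; exact: floor_def.
have mcell k : measurable (cell k).
  have [->|/set0P/cellE[z ->]] := eqVneq (cell k) set0 => //.
have FD k : F m (D k) by exact: martingale_adapted.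
have mD k : measurable (D k) by exact: filtration_measurable (FD k).
have DT : setT = \bigcup_k D k.
  by apply/seteqP; split => w // _; exists (pickle (Num.floor (S m w / eps))).
have tD : trivIset setT D by move=> i j _ _ [w [/= <- <-]].
have msqr : measurable_fun setT (fun x : R => x ^+ 2) by exact: measurable_funX.
have msqre : measurable_fun setT (fun x : R => x ^+ 2 + e) by exact: measurable_funD.
have mS k (f : R -> R) : measurable_fun setT f ->
  measurable_fun setT (EFin \o (f \o S k)).
  by move=> mf; apply/measurable_EFinP; exact: measurableT_comp.
apply: (@le_trans _ _ (\int[P]_w (S n w ^+ 2 + e)%:E)%E); last first.
  under eq_integral do rewrite EFinD.
  rewrite ge0_integralD//=; last 3 first.
  - by move=> w _; rewrite lee_fin sqr_ge0.
  - exact: (mS n (fun x => x ^+ 2)).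
  - by move=> w _; rewrite lee_fin ltW.
  by rewrite integral_cst//= probability_setT mule1.
rewrite DT !ge0_integral_bigcup//=; last 4 first.
- by rewrite -DT; exact: (mS n (fun x => x ^+ 2 + e)).
- by move=> w _; rewrite lee_fin addr_ge0 ?sqr_ge0// ltW.
- by rewrite -DT; exact: (mS m (fun x => x ^+ 2)).
- by move=> w _; rewrite lee_fin sqr_ge0.
apply: lee_nneseries => k _.
  by move=> _; apply: integral_ge0 => w _; rewrite lee_fin sqr_ge0.
have [Dk|/set0P[w /= Dw]] := eqVneq (D k) set0.
  by rewrite Dk !integral_set0.
have [z zE] : exists z : int, cell k = `[z%:~R * eps, (z + 1)%:~R * eps[%classic.
  by apply: cellE; exists (S m w).
pose c := z%:~R * eps.
apply: (@martingale_jensen m n _ (fun x => x ^+ 2) (fun x => x ^+ 2 + e)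
  (2 * c) (e - c ^+ 2)) => //.
- by move=> y; exact: sqr_ge0.
- by move=> y; rewrite addr_ge0 ?sqr_ge0// ltW.
- move=> w'; rewrite /D /= zE /= in_itv/= intrD mulrDl mul1r -/c => /andP[h1 h2].
  have -> : e = eps ^+ 2 by rewrite sqr_sqrtr// ltW.
  nra.
- by move=> y; have := sqr_ge0 (y - c); nra.
Qed.

End martingale_inequalities.

(** * Blocks of a partition *)

Section partition_bound.
Context {R : realType} {d : measure_display} {Omega : measurableType d}.
Variables (P : probability Omega R) (S : nat -> {RV P >-> R}).
Variable F : nat -> set (set Omega).
Hypothesis SF : centered_martingale S F.
Hypothesis hV : forall n, (0 < 'V_P[S n] < +oo)%E.

Let varE n : 'V_P[S n] = (\int[P]_w ((S n w) ^+ 2)%:E)%E.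
Proof.
have [_ _ _ E0] := SF.
rewrite /variance covariance.unlock E0 fine0 expectation.unlock.
by apply: eq_integral => w _; rewrite !fctE /= subr0 expr2.
Qed.

Lemma stdev_gt0 n : 0 < stdev (S n).
Proof. by rewrite sqrtr_gt0 fine_gt0. Qed.

Lemma martingale_stdev_le m n : (m <= n)%N -> stdev (S m) <= stdev (S n).
Proof.
move=> mn; apply: ler_wsqrtr; apply: fine_le.
- by have /andP[/ltW V0 Voo] := hV m; rewrite ge0_fin_numE.
- by have /andP[/ltW V0 Voo] := hV n; rewrite ge0_fin_numE.
- by rewrite !varE; exact: (martingale_sqr_le SF).
Qed.

Variables (l0 : \bar R) (phi : R -> R).
Hypothesis hphi : classPhi l0 phi.

Lemma Bphi_norm_ltP (X : {RV P >-> R}) (b : R) :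
  (Bphi_norm l0 phi X < b%:E)%E ->
  exists tau, [/\ 0 < tau, tau < b &
    forall l, ('M_P X l <= expeR (phi_ext l0 phi (l * tau)))%E].
Proof. by move=> /ereal_inf_lt[_ [tau [tau0 htau] <-]]; exists tau. Qed.

Variables (k : R).
Hypothesis k0 : 0 < k.
Hypothesis hnorm : forall n, (Bphi_norm l0 phi (S n) < (k * stdev (S n))%:E)%E.

(** Every [l] of the domain of [phi] gives a bound. For [l > 0] it comes from
    [doob_chernoff] with the parameter [s * l / tau], where [tau] is admissible
    for the norm of [S n]; the moment generating function there is at most
    [exp (phi (s * l)) = exp (phi l)]. For [l <= 0] the exponent
    [l * y - phi l] at [y = x / (k * stdev (S n))] is at most 0, and the bound
    is at least 1. *)
Lemma maximal_young_fenchel n (s x : R) (E : nat -> set Omega) :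
  `|s| = 1 -> 0 < x -> (forall i, F i (E i)) ->
  (forall i w, (i <= n)%N -> E i w -> x <= s * S i w) ->
  (P (\big[setU/set0]_(i < n.+1) E i) <=
   expeR (- young_fenchel l0 phi (x / (k * stdev (S n)))))%E.
Proof.
move=> s1 x0 FE Ex.
have mE : measurable (\big[setU/set0]_(i < n.+1) E i).
  by apply: bigsetU_measurable => i _; exact: (filtration_measurable SF (FE i)).
set p := P _; have p0 : (0 <= p)%E by exact: measure_ge0.
have /eqP pE : expeR (lne p) == p by rewrite lneK_eq.
rewrite -pE.
(* In logarithmic form the bound on [p] is an upper bound of the supremum that
   defines the Young-Fenchel transform. *)
rewrite lee_expeR leeNr; apply: ge_ereal_sup => _ [l l_in <-].
rewrite leeNr -lee_expeR pE.
have [l_le0|l_gt0] := leP l 0.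
  apply: (@le_trans _ _ 1%E); first exact: probability_le1.
  rewrite -expeR0 lee_expeR lee_fin oppr_ge0 subr_le0.
  apply: (@le_trans _ _ 0).
    by rewrite mulr_le0_ge0// ltW// divr_gt0// mulr_gt0// stdev_gt0.
  move: l_le0; rewrite le_eqVlt => /predU1P[->|l_lt0].
    by rewrite (Phi_0 hphi).
  rewrite -(Phi_even hphi)//; apply/ltW/(Phi_pos hphi); last by rewrite oppr_gt0.
  by rewrite /symitv/= normrN.
have [tau [tau0 tauk htau]] := Bphi_norm_ltP (hnorm n).
apply: le_trans (doob_chernoff SF (n := n) (l := l / tau * s) (x := l / tau * x) FE _) _.
  move=> i w lein /Ex-/(_ lein) xs.
  by rewrite -[leRHS]mulrA ler_pM2l// divr_gt0.
apply: (@le_trans _ _ ((expR (- (l / tau * x)))%:E * (expR (phi l))%:E)%E).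
  rewrite lee_pmul2l ?lte_fin ?expR_gt0//.
  have := htau (l / tau * s); rewrite mulrAC mulfVK ?gt_eqF//.
  have ls : `|l * s| = `|l| by rewrite normrM s1 mulr1.
  have ->: phi_ext l0 phi (l * s) = (phi l)%:E; last by [].
  rewrite /phi_ext ls (l_in : (`|l|%:E < l0)%E).
  have [->|->] : s = 1 \/ s = -1 by move: s1; case: (ger0P s) => _ <-; [left|right; rewrite opprK].
    by rewrite mulr1.
  by rewrite mulrN1 (Phi_even hphi).
rewrite -EFinM -expRD lee_fin ler_expR opprB addrC lerD2l lerN2.
have -> : l / tau * x = l * (x * tau^-1) by ring.
by rewrite !ler_pM2l// lef_pV2 ?posrE ?mulr_gt0 ?stdev_gt0// ltW.
Qed.

Variable v : nat -> R.
Hypothesis v0 : forall n, 0 < v n.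
Hypothesis vmono : {homo v : m n / (m <= n)%N >-> m <= n}.

(** The inequality is cleared of its denominator; [s] is [1] for the upper tail
    of [S] and [-1] for the lower one. *)
Definition exceed (s u : R) n : set Omega :=
  [set w | u * (stdev (S n) * v n) < s * S n w].

Lemma exceed_filtration s u n : F n (exceed s u n).
Proof.
pose B := [set y : R | u * (stdev (S n) * v n) < s * y].
have mB : measurable B.
  have -> : B = setT `&` ( *%R s @^-1` `]u * (stdev (S n) * v n), +oo[%classic).
    by apply/seteqP; split => y /=; rewrite in_itv/= andbT; [split|case].
  have : measurable_fun setT ( *%R s : R -> R) by exact: measurable_funM.
  by apply; [exact: measurableT|exact: measurable_itv].
exact: (martingale_adapted SF n mB).
Qed.

Lemma measurable_exceed s u n : measurable (exceed s u n).
Proof. exact: (filtration_measurable SF (exceed_filtration s u n)). Qed.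

Lemma partition_block (A : nat -> nat) n : partitions A ->
  exists j, (A j <= n <= right_end A j)%N.
Proof.
move=> [A0 Alt _]; rewrite /right_end.
have S_le j : (n <= (A j.+1).-1)%N = (n < A j.+1)%N.
  by rewrite -[in RHS](@prednK (A j.+1)) ?ltnS//; apply: leq_ltn_trans (Alt j).
suff [j jn] : exists j, (A j <= n < A j.+1)%N by exists j; rewrite S_le.
elim: n {S_le} => [|n [j /andP[An nA]]]; first by exists 0%N; rewrite A0 -[ltnLHS]A0 Alt.
have [lt|ge] := ltnP n.+1 (A j.+1); first by exists j; rewrite (leqW An).
by exists j.+1; rewrite ge (leq_ltn_trans nA).
Qed.

Lemma exceed_le_Q (s u : R) (A : nat -> nat) : `|s| = 1 -> 0 < u -> partitions A ->
  (P (\bigcup_n exceed s u n) <=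
   Q l0 phi (fun n => stdev (S n)) A v (k^-1 * u))%E.
Proof.
move=> s1 u0 pA.
pose E j i := if (A j <= i)%N then exceed s u i else set0.
pose U j := \big[setU/set0]_(i < (right_end A j).+1) E j i.
have FE j i : F i (E j i).
  rewrite /E; case: ifP => _; first exact: exceed_filtration.
  by rewrite -(filtration_gen SF); exact: sigma_algebra0.
have mU j : measurable (U j).
  by apply: bigsetU_measurable => i _; exact: (filtration_measurable SF (FE j i)).
apply: (@le_trans _ _ (\sum_(0 <= j <oo) P (U j))%E).
  apply: measure_sigma_subadditive => //.
    by apply: bigcup_measurable => n _; exact: measurable_exceed.
  move=> w [n _ wn]; have [j /andP[An nB]] := partition_block n pA.
  exists j => //; rewrite /U -bigcup_mkord; exists n => //=.
  by rewrite /E An.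
apply: lee_nneseries => [j _ _|j _]; first exact: measure_ge0.
set x := u * (stdev (S (A j)) * v (A j)).
have -> : k^-1 * u * stdev (S (A j)) * v (A j) / stdev (S (right_end A j)) =
    x / (k * stdev (S (right_end A j))).
  by rewrite /x invfM; ring.
apply: (maximal_young_fenchel (s := s)) => //.
  by rewrite /x !mulr_gt0// stdev_gt0.
move=> i w _; rewrite /E; case: ifPn => // Ai /ltW; apply: le_trans.
rewrite /x ler_pM2l// ler_pM ?(ltW (stdev_gt0 _)) ?(ltW (v0 _))//.
  exact: martingale_stdev_le.
exact: vmono.
Qed.

Let sv_gt0 n : 0 < stdev (S n) * v n.
Proof. by rewrite mulr_gt0// stdev_gt0. Qed.

Lemma W_exceed u : W S v u = P (\bigcup_n exceed 1 u n).
Proof.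
congr (P _); apply/seteqP; split => w /=.
  move=> /ereal_sup_gt[_ [n _ <-]]; rewrite lte_fin ltr_pdivlMr// => h.
  by exists n => //; rewrite /exceed/= mul1r.
move=> [n _]; rewrite /exceed/= mul1r => h.
apply: (@lt_le_trans _ _ (S n w / (stdev (S n) * v n))%:E).
  by rewrite lte_fin ltr_pdivlMr.
by apply: ereal_sup_ubound; exists n.
Qed.

Lemma Wplus_exceed u :
  Wplus S v u = P (\bigcup_n exceed 1 u n `|` \bigcup_n exceed (-1) u n).
Proof.
congr (P _); apply/seteqP; split => w /=.
  move=> /ereal_sup_gt[_ [n _ <-]]; rewrite lte_fin ltr_pdivlMr// ltr_normr.
  by case/orP => h; [left|right]; exists n => //; rewrite /exceed/= ?mul1r ?mulN1r.
move=> h; have [n hn] : exists n, u * (stdev (S n) * v n) < `|S n w|.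
  case: h => -[n _]; rewrite /exceed/= ?mul1r ?mulN1r => h;
  by exists n; rewrite ltr_normr h ?orbT.
apply: (@lt_le_trans _ _ (`|S n w| / (stdev (S n) * v n))%:E).
  by rewrite lte_fin ltr_pdivlMr.
by apply: ereal_sup_ubound; exists n.
Qed.

Lemma W_le_Q u A : 0 < u -> partitions A ->
  (W S v u <= Q l0 phi (fun n => stdev (S n)) A v (k^-1 * u))%E.
Proof. by move=> *; rewrite W_exceed; apply: exceed_le_Q => //; exact: normr1. Qed.

Lemma Wplus_le_Q u A : 0 < u -> partitions A ->
  (Wplus S v u <= 2%:E * Q l0 phi (fun n => stdev (S n)) A v (k^-1 * u))%E.
Proof.
move=> u0 pA; rewrite Wplus_exceed.
have mW s : measurable (\bigcup_n exceed s u n).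
  by apply: bigcup_measurable => n _; exact: measurable_exceed.
apply: le_trans (measureU2 _ (mW _) (mW _)) _.
rewrite -[2]/(1 + 1) EFinD ge0_muleDl// !mul1e.
by apply: leeD; apply: exceed_le_Q => //; rewrite ?normrN normr1.
Qed.

End partition_bound.

(** * Tail estimates *)

Theorem mainTheorem1 (R : realType) (l0 : \bar R) (phi : R -> R)
    (hphi : classPhi l0 phi) :
  exists C : R -> R, (forall K, 0 < C K) /\
  forall (d : measure_display) (Omega : measurableType d)
    (P : probability Omega R)
    (S : nat -> {RV P >-> R}) (F : nat -> set (set Omega)) (v : nat -> R),
  centered_martingale S F ->
  (forall n, 0 < 'V_P[S n] < +oo)%E ->
  (forall n, 0 < v n) ->
  {homo v : m n / (m <= n)%N >-> m <= n} ->
  (forall n, inBphi l0 phi (S n)) ->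
  let sigma n := stdev (S n) in
  let K := ereal_sup [set (Bphi_norm l0 phi (S n) * ((sigma n)^-1)%:E)%E
                     | n in [set: nat]] in
  (K < +oo)%E ->
  let c := C (fine K) in
  forall u : R, 0 < u ->
  (W S v u <= ereal_inf [set Q l0 phi sigma A v (c * u) | A in partitions])%E /\
  (Wplus S v u <=
    2%:E * ereal_inf [set Q l0 phi sigma A v (c * u) | A in partitions])%E.
Proof.
(* Adding 1 makes the inequality between the norm and the bound strict, so that
   some [tau] below the bound is admissible; the absolute value makes [C]
   positive everywhere. *)
exists (fun K => (`|K| + 1)^-1); split.
  by move=> K; rewrite invr_gt0 ltr_wpDl.
move=> d Omega P S F v SF hV v0 vmono _ sigma K Koo c u u0.
have sigma0 n : 0 < sigma n by exact: stdev_gt0.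
have k0 : 0 < `|fine K| + 1 by rewrite ltr_wpDl.
have Kge n : (Bphi_norm l0 phi (S n) * ((sigma n)^-1)%:E <= K)%E.
  by apply: ereal_sup_ubound; exists n.
have K0 : (0 <= K)%E.
  apply: le_trans (Kge 0%N); rewrite mule_ge0//; last by rewrite lee_fin invr_ge0 ltW.
  by apply: le_ereal_inf_tmp => _ [tau [tau0 _] <-]; rewrite lee_fin ltW.
have KE : K = (fine K)%:E by rewrite fineK// ge0_fin_numE.
have hnorm n : (Bphi_norm l0 phi (S n) < ((`|fine K| + 1) * sigma n)%:E)%E.
  rewrite EFinM -lte_pdivrMr//; apply: le_lt_trans (Kge n) _.
  by rewrite {1}KE lte_fin (le_lt_trans (ler_norm _))// ltrDl.
split.
  apply: le_ereal_inf_tmp => _ [A pA <-].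
  exact: (W_le_Q SF hV hphi k0 hnorm v0 vmono u0 pA).
rewrite -lee_pdivrMl//; apply: le_ereal_inf_tmp => _ [A pA <-].
rewrite lee_pdivrMl//.
exact: (Wplus_le_Q SF hV hphi k0 hnorm v0 vmono u0 pA).
Qed.
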